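(* Let $G=(V,E,w)$ be a weighted hypergraph with $E\neq\varnothing$ and with connected components $S_1,\dots,S_l$. Let $q\in[1,\infty]$ and $p\ge 1$ ($p<\infty$). Then every $x\in\mathbb{R}^V$ and every $y\in L_{G,p}(x)$ satisfy $$|x-\overline{x}|_{\ell^q}^p\le C\,x\cdot y=p\,C\,\varphi_{G,p}(x),$$ where $$C=C_{G,p}:=\frac{1}{\min_{e\in E}w(e)}\left(\sum_{j=1}^{l}(\#S_j)^{2-\frac1p}\right)^p .$$
   Context: A weighted hypergraph $G=(V,E,w)$ consists of a finite set $V=\{v_1,\dots,v_n\}$, a set $E\subset 2^V$ of hyperedges, each $e\in E$ containing more than one element of $V$, and a weight function $w:E\to(0,\infty)$. $\mathbb{R}^V$ is the space of functions $x:V\to\mathbb{R}$ with inner product $x\cdot y=\sum_{v\in V}x(v)y(v)$ and norms $|x|_{\ell^q}=(\sum_{v\in V}|x(v)|^q)^{1/q}$ for $q\in[1,\infty)$, $|x|_{\ell^\infty}=\max_{v\in V}|x(v)|$. For $S\subset V$, $1_S\in\mathbb{R}^V$ is the indicator function of $S$, $1_v:=1_{\{v\}}$, and $\#S$ is the number of elements of $S$. For $e\in E$ let $B_e:=\operatorname{conv}\{1_u-1_v:\ u,v\in e\}$ and $f_e(x):=\max_{u,v\in e}(x(u)-x(v))=\max_{b\in B_e}b\cdot x$. For $p\in[1,\infty)$ define $\varphi_{G,p}(x):=\frac1p\sum_{e\in E}w(e)(f_e(x))^p$, and let the hypergraph $p$-Laplacian be its (multivalued) subdifferential $$L_{G,p}(x):=\partial\varphi_{G,p}(x)=\Big\{\sum_{e\in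 E}w(e)(f_e(x))^{p-1}b_e:\ b_e\in\operatorname{argmax}_{b\in B_e}b\cdot x\Big\}.$$ (When $p=1$, the factor $(f_e(x))^{p-1}$ is $1$.) Connected components: $S_1,\dots,S_l$ are the equivalence classes of $V$ under the relation: $u\sim v$ iff $u=v$ or there are $u_0=u,u_1,\dots,u_k=v$ in $V$ and $e_1,\dots,e_k\in E$ with $u_{j-1},u_j\in e_j$ for all $j=1,\dots,k$. For $x\in\mathbb{R}^V$, $\overline{x}\in\mathbb{R}^V$ is the componentwise average: $\overline{x}:=\sum_{k=1}^l c_k1_{S_k}$ with $c_k=\frac{1}{\#S_k}\sum_{v\in S_k}x(v)$. *)

(* Defs.v *)
From mathcomp Require Import all_boot all_order all_algebra.
From mathcomp Require Import all_classical all_reals all_analysis.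
From mathcomp Require Import ring lra.

Set Implicit Arguments.
Unset Strict Implicit.
Unset Printing Implicit Defensive.

Import Order.TTheory GRing.Theory Num.Theory.
Local Open Scope classical_set_scope.
Local Open Scope ring_scope.

(* The weight is a total function on subsets of [V]; only its values on
   hyperedges are constrained or used. *)
Record hypergraph (R : realType) (V : finType) := Hypergraph {
  hedges : {set {set V}};
  hweight : {set V} -> R;
  hedges_gt1 : forall e, e \in hedges -> (1 < #|e|)%N;
  hweight_gt0 : forall e, e \in hedges -> 0 < hweight e }.

Section Vectors.
Variables (R : realType) (V : finType).
Implicit Types (x y z : {ffun V -> R}) (S e : {set V}).

Definition dotv x y : R := \sum_v x v * y v.

Definition indicator S : {ffun V -> R} := [ffun v => (v \in S)%:R].

(* The value at [-oo] is junk: [q] is meant to range over [1, +oo]. *)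
Definition lqnorm (q : \bar R) x : R :=
  match q with
  | r%:E => (\sum_v `|x v| `^ r) `^ r^-1
  | +oo%E => \big[Num.max/0]_v `|x v|
  | -oo%E => 0
  end.

(* The default value 0 of the maximum is attained at u = v when [e] is
   nonempty. *)
Definition edge_max e x : R :=
  \big[Num.max/0]_(u in e) \big[Num.max/0]_(v in e) (x u - x v).

Definition subdifferential (f : {ffun V -> R} -> R) x : set {ffun V -> R} :=
  [set y | forall z, f x + dotv y (z - x) <= f z].

Definition conv_hull (A : set {ffun V -> R}) : set {ffun V -> R} :=
  [set b | forall C : set {ffun V -> R}, convex_set C -> A `<=` C -> C b].

Definition edge_polytope e : set {ffun V -> R} :=
  conv_hull [set b | exists u v,
    [/\ u \in e, v \in e & b = indicator [set u] - indicator [set v]]].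

Definition edge_argmax e x : set {ffun V -> R} :=
  [set b | edge_polytope e b /\
           forall b', edge_polytope e b' -> dotv b' x <= dotv b x].

End Vectors.

Section Hypergraph.
Variables (R : realType) (V : finType) (G : hypergraph R V).
Implicit Types (p : R) (x : {ffun V -> R}).

Definition hadj : rel V :=
  fun u v => [exists e in hedges G, (u \in e) && (v \in e)].

(* [connect hadj] is the reflexive transitive closure of [hadj]. *)
Definition components : {set {set V}} :=
  equivalence_partition (connect hadj) [set: V].

Definition component_average x : {ffun V -> R} :=
  \sum_(S in components) ((\sum_(v in S) x v) / #|S|%:R) *: indicator R S.

Definition energy p x : R :=
  p^-1 * \sum_(e in hedges G) hweight G e * edge_max e x `^ p.

Definition laplacian p x : set {ffun V -> R} := subdifferential (energy p) x.

(* An infimum over a finite set; it is a minimum when [hedges G] is nonempty. *)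
Definition min_weight : R := inf [set hweight G e | e in [set` hedges G]].

Definition poincare_const p : R :=
  min_weight^-1 * (\sum_(S in components) #|S|%:R `^ (2 - p^-1)) `^ p.

End Hypergraph.

Section LaplacianFormula.
Variables (R : realType) (V : finType).
Implicit Types (x y z b : {ffun V -> R}) (e : {set V}).

Lemma dotvBl x y z : dotv (x - y) z = dotv x z - dotv y z.
Proof.
by rewrite /dotv -sumrB; apply: eq_bigr => v _; rewrite !ffunE mulrBl.
Qed.

Lemma dotvBr x y z : dotv x (y - z) = dotv x y - dotv x z.
Proof.
by rewrite /dotv -sumrB; apply: eq_bigr => v _; rewrite !ffunE mulrBr.
Qed.

Lemma dotv_indicator1 u x : dotv (indicator R [set u]) x = x u.
Proof.
rewrite /dotv (bigD1 u)//= big1 ?addr0 => [|v vu];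
  by rewrite ffunE inE ?eqxx ?mul1r// (negbTE vu) mul0r.
Qed.

Lemma edge_max_ge0 e x : 0 <= edge_max e x.
Proof. by rewrite /edge_max; apply: bigmax_ge_id. Qed.

Lemma edge_max_ge e x u v : u \in e -> v \in e -> x u - x v <= edge_max e x.
Proof.
move=> ue ve; rewrite /edge_max; apply: le_trans (le_bigmax_cond _ _ ue).
exact: (le_bigmax_cond _ (fun v => x u - x v)).
Qed.

Lemma edge_polytope_le e b x : edge_polytope e b -> dotv b x <= edge_max e x.
Proof.
move=> /(_ [set b | dotv b x <= edge_max e x]); apply.
  move=> c d t; rewrite !inE /= => hc hd.
  set r := t%:num; set s := 1 - r.
  have r0 : 0 <= r by rewrite /r.
  have s0 : 0 <= s by rewrite /s /r subr_ge0.
  change (dotv (r *: (c : {ffun V -> R}) + s *: (d : {ffun V -> R})) x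
            <= edge_max e x).
  have -> : dotv (r *: (c : {ffun V -> R}) + s *: (d : {ffun V -> R})) x =
      r * dotv c x + s * dotv d x.
    rewrite /dotv !mulr_sumr -big_split; apply: eq_bigr => v _ /=.
    by rewrite !ffunE mulrDl !mulrA.
  have -> : edge_max e x = r * edge_max e x + s * edge_max e x.
    by rewrite -mulrDl /s addrC subrK mul1r.
  by apply: lerD; apply: ler_wpM2l.
move=> _ [u [v [ue ve ->]]] /=.
by rewrite dotvBl !dotv_indicator1; exact: edge_max_ge.
Qed.

Lemma edge_argmaxE e b x : e != finset.set0 -> edge_argmax e x b ->
  dotv b x = edge_max e x.
Proof.
move=> /set0Pn[u0 u0e] [be bmax]; apply/eqP; rewrite eq_le edge_polytope_le//=.
have bpair u v : u \in e -> v \in e -> x u - x v <= dotv b x.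
  move=> ue ve; have := bmax (indicator R [set u] - indicator R [set v]).
  rewrite dotvBl !dotv_indicator1; apply => C _; apply.
  by exists u, v.
have b0 : 0 <= dotv b x by rewrite -(subrr (x u0)); exact: bpair.
by apply/bigmax_leP; split => // u ue; apply/bigmax_leP; split => // v; apply: bpair.
Qed.

Lemma powR_tangent (p s t : R) : 1 <= p -> 0 <= s -> 0 <= t ->
  p^-1 * t `^ p + t `^ (p - 1) * (s - t) <= p^-1 * s `^ p.
Proof.
move=> p1 s0 t0; have p0 : 0 < p by apply: lt_le_trans p1.
have [->|pN1] := eqVneq p 1.
  by rewrite subrr powRr0 !powRr1// invr1 !mul1r addrC subrK.
have p1' : 1 < p by rewrite lt_neqAle eq_sym pN1.
have pB0 : p - 1 != 0 by rewrite subr_eq0.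
have q0 : 0 < p / (p - 1) by rewrite divr_gt0// subr_gt0.
have pq : p^-1 + (p / (p - 1))^-1 = 1 by field; rewrite pB0 gt_eqF.
have := conjugate_powR s0 (powR_ge0 t (p - 1)) p0 q0 pq.
rewrite -powRrM [(p - 1) * _]mulrC divfK//.
have -> : (p / (p - 1))^-1 = 1 - p^-1.
  by apply/eqP; rewrite eq_sym subr_eq addrC pq.
have := mulr_powRB1 t0 p0.
move: (t `^ p) (t `^ (p - 1)) (s `^ p) => a b c; lra.
Qed.

(* The explicit description of the hypergraph p-Laplacian is covered by the
   definition of [laplacian] as a subdifferential. For p = 1 the factor
   [edge_max e x `^ (p - 1)] is 1, also when [edge_max e x = 0]. *)
Lemma laplacian_formula (G : hypergraph R V) (p : R) x
    (b : {set V} -> {ffun V -> R}) : 1 <= p ->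
  (forall e, e \in hedges G -> edge_argmax e x (b e)) ->
  laplacian G p x
    (\sum_(e in hedges G) (hweight G e * edge_max e x `^ (p - 1)) *: b e).
Proof.
move=> p1 hb z /=.
have -> : dotv (\sum_(e in hedges G)
      (hweight G e * edge_max e x `^ (p - 1)) *: b e) (z - x) =
    \sum_(e in hedges G)
      (hweight G e * edge_max e x `^ (p - 1)) * dotv (b e) (z - x).
  rewrite /dotv; under eq_bigr do rewrite sum_ffunE mulr_suml.
  rewrite exchange_big /=; apply: eq_bigr => e _; rewrite mulr_sumr.
  by apply: eq_bigr => v _; rewrite ffunE mulrA.
rewrite /energy !mulr_sumr -big_split /=; apply: ler_sum => e eG.
have w0 := hweight_gt0 eG.
have eN0 : e != finset.set0 by rewrite -card_gt0 ltnW// (hedges_gt1 eG).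
rewrite dotvBr (edge_argmaxE eN0 (hb e eG)) mulrCA [leRHS]mulrCA -mulrA -mulrDr.
apply: ler_wpM2l; first exact: ltW.
apply: le_trans (powR_tangent p1 (edge_max_ge0 e z) (edge_max_ge0 e x)).
rewrite lerD2l; apply: ler_wpM2l; first exact: powR_ge0.
by rewrite lerD2r; apply: edge_polytope_le; case: (hb e eG).
Qed.

End LaplacianFormula.

(* Main.v *)
Require Import Defs.
From mathcomp Require Import all_boot all_order all_algebra.
From mathcomp Require Import all_classical all_reals all_analysis.
From mathcomp Require Import ring lra.

Set Implicit Arguments.
Unset Strict Implicit.
Unset Printing Implicit Defensive.

Import Order.TTheory GRing.Theory Num.Theory.
Local Open Scope ring_scope.

(** The energy is positively p-homogeneous, so Euler's identity for
subgradients ([laplacian_euler]) gives [x . y = p * energy]; this is the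
asserted equality, and it reduces the inequality to a bound on
[|x - average|] by [T := \sum_e f_e(x)^p], where [f_e] is [edge_max e] and
the weights are at least their minimum.

The bound on [x - average] is a chaining argument. Two vertices u, v of a
component S are joined by a simple path, along which x changes at each step
by at most [f_e(x)] for an edge e. Skipping, from the current vertex, to the
last vertex of the path that lies in the current edge makes the edges used
pairwise distinct ([path_distinct_edges]), so that the power mean inequality
bounds [|x(u) - x(v)|] by [k^(1 - 1/p) * T^(1/p)] with [k < #S] edges
([oscillation_le]). Distinctness matters here: each edge contributes to T only
once. The average over S is no further from [x(v)] than the values on S are, so
summing over the #S vertices of S and over all components gives
[|x - average|_1 <= (\sum_S #S^(2 - 1/p)) * T^(1/p)] ([l1_deviation_le]). The
l^1 norm dominates every l^q norm. *)

(** * Real inequalities *)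

(** Jensen's inequality for [t^p]: sum over A the tangent inequality
[powR_tangent] at the mean of [a], where the linear terms cancel, and take
p-th roots. *)
Lemma sum_le_power_mean (R : realType) (I : finType) (A : {set I}) (a : I -> R)
    (p : R) :
  1 <= p -> (forall i, i \in A -> 0 <= a i) ->
  \sum_(i in A) a i <=
    #|A|%:R `^ (1 - p^-1) * (\sum_(i in A) a i `^ p) `^ p^-1.
Proof.
move=> p1 a0; have p0 : 0 < p by apply: lt_le_trans p1.
have [->|A0] := eqVneq A finset.set0.
  by rewrite big_set0; apply: mulr_ge0; exact: powR_ge0.
set N : R := #|A|%:R; set S := \sum_(i in A) a i; set T := \sum_(i in A) _.
have N0 : 0 < N by rewrite ltr0n card_gt0.
have S0 : 0 <= S by apply: sumr_ge0.
have m0 : 0 <= S / N by rewrite divr_ge0// ltW.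
have NT : N * (S / N) `^ p <= T.
  rewrite -(ler_pM2l (x := p^-1)) ?invr_gt0//.
  have -> : p^-1 * (N * (S / N) `^ p) =
      \sum_(i in A) (p^-1 * (S / N) `^ p + (S / N) `^ (p - 1) * (a i - S / N)).
    rewrite big_split /= sumr_const -mulr_sumr sumrB sumr_const -mulr_natr -/N.
    rewrite -[_ *+ _]mulr_natr -/N -/S.
    by rewrite divfK ?gt_eqF// subrr mulr0 addr0 mulrCA mulrC.
  rewrite /T mulr_sumr; apply: ler_sum => i iA.
  by apply: powR_tangent => //; exact: a0.
have : (N * (S / N) `^ p) `^ p^-1 <= T `^ p^-1.
  apply: ge0_ler_powR => //; rewrite ?nnegrE ?invr_ge0 ?(ltW p0)//.
    by rewrite mulr_ge0 ?powR_ge0 ?ltW.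
  by apply: sumr_ge0 => i _; exact: powR_ge0.
rewrite powRM ?(ltW N0) ?powR_ge0// -powRrM mulfV ?gt_eqF// powRr1//.
move=> /(ler_wpM2l (powR_ge0 N (1 - p^-1))); rewrite [leLHS]mulrA -powRD.
  by rewrite subrK powRr1 ?(ltW N0)// mulrCA mulfV ?gt_eqF// mulr1.
by rewrite (gt_eqF N0) implybT.
Qed.

Lemma dist_mean_le (R : realFieldType) (I : finType) (A : {set I}) (a : I -> R)
    (b D : R) :
  A != finset.set0 -> (forall i, i \in A -> `|b - a i| <= D) ->
  `|b - (\sum_(i in A) a i) / #|A|%:R| <= D.
Proof.
move=> A0 bD; have N0 : (0 : R) < #|A|%:R by rewrite ltr0n card_gt0.
have -> : b - (\sum_(i in A) a i) / #|A|%:R =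
    (\sum_(i in A) (b - a i)) / #|A|%:R.
  by rewrite sumrB sumr_const -[b *+ _]mulr_natr mulrBl mulfK ?gt_eqF.
rewrite normrM normfV (gtr0_norm N0) ler_pdivrMr//.
apply: le_trans (ler_norm_sum _ _ _) _.
by rewrite mulr_natr -sumr_const; apply: ler_sum.
Qed.

Lemma lqnorm_ge0 (R : realType) (V : finType) (q : \bar R) (z : {ffun V -> R}) :
  0 <= lqnorm q z.
Proof. by case: q => [r| |] //=; [exact: powR_ge0 | exact: bigmax_ge_id]. Qed.

(** With [s] the l^1 norm, [|z(v)| <= s] gives [|z(v)|^r <= |z(v)| * s^(r - 1)],
and these sum to at most [s^r]. *)
Lemma lqnorm_le_l1 (R : realType) (V : finType) (q : \bar R)
    (z : {ffun V -> R}) :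
  (1%:E <= q)%E -> lqnorm q z <= \sum_v `|z v|.
Proof.
have s0 : 0 <= \sum_v `|z v| by apply: sumr_ge0.
have zs v : `|z v| <= \sum_v `|z v|.
  by rewrite (bigD1 v)//= lerDl; apply: sumr_ge0.
case: q => [r| |]//=; last by move=> _; apply: bigmax_le => // v _; exact: zs.
rewrite lee_fin => r1; have r0 : 0 < r by apply: lt_le_trans r1.
set s : R := \sum_v `|z v| in s0 zs *.
have -> : s = (s `^ r) `^ r^-1 by rewrite -powRrM mulfV ?gt_eqF// powRr1.
apply: ge0_ler_powR; rewrite ?nnegrE ?invr_ge0 ?(ltW r0) ?powR_ge0//.
  by apply: sumr_ge0 => v _; exact: powR_ge0.
rewrite -mulr_powRB1// {1}/s mulr_suml; apply: ler_sum => v _.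
rewrite -mulr_powRB1//; apply: ler_wpM2l => //.
by apply: ge0_ler_powR; rewrite ?nnegrE ?subr_ge0.
Qed.

(** * Euler's identity for the subdifferential of a homogeneous function *)

Lemma dotvZr (R : realType) (V : finType) (t : R) (x y : {ffun V -> R}) :
  dotv x (t *: y) = t * dotv x y.
Proof.
rewrite /dotv mulr_sumr; apply: eq_bigr => v _.
by rewrite ffunE mulrCA.
Qed.

Lemma dotvC (R : realType) (V : finType) (x y : {ffun V -> R}) :
  dotv x y = dotv y x.
Proof. by apply: eq_bigr => v _; rewrite mulrC. Qed.

(** The subgradient inequality at the points [t *: x] says that
[t^p * f(x) - t * (x . y)] is minimal at [t = 1], so its derivative
[p * f(x) - x . y] vanishes there. *)
Lemma subdifferential_euler (R : realType) (V : finType)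
    (f : {ffun V -> R} -> R) (p : R) (x y : {ffun V -> R}) :
  (forall t, 0 < t -> f (t *: x) = t `^ p * f x) ->
  subdifferential f x y -> dotv x y = p * f x.
Proof.
move=> fhom hy.
pose g (t : R) := t `^ p * f x - t * dotv x y.
have dg (t : R) : 0 < t ->
    is_derive t 1 g (p * t `^ (p - 1) * f x - dotv x y).
  move=> t0; rewrite /g.
  have H := is_derive1_powR p t0.
  have D := is_deriveB (is_deriveM H (is_derive_cst (f x) t 1))
     (is_deriveM (is_derive_id t 1) (is_derive_cst (dotv x y) t 1)).
  apply: is_derive_eq D _.
  by rewrite !scaler0 !add0r /GRing.scale /= mulr1 mulrC.
have g0 : is_derive (1 : R) 1 g 0.
  apply: (@derive1_at_min _ g 0 2 1) => //.
  - by move=> t; rewrite in_itv /= => /andP[t0 _]; case: (dg t t0).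
  - by rewrite in_itv /= ltr01 ltr1n.
  - move=> t; rewrite in_itv /= => /andP[t0 _].
    have := hy (t *: x); rewrite fhom// dotvBr dotvZr (dotvC y) /g powR1.
    by lra.
have g1 := dg 1 ltr01.
have := @derive_val _ _ _ _ _ _ _ g0; rewrite (@derive_val _ _ _ _ _ _ _ g1).
by rewrite powR1 mulr1 => /subr0_eq.
Qed.

Lemma edge_maxZ (R : realType) (V : finType) (e : {set V}) (t : R)
    (x : {ffun V -> R}) :
  0 <= t -> edge_max e (t *: x) = t * edge_max e x.
Proof.
move=> t0; rewrite /edge_max.
have Mmax : {morph *%R t : a b / Num.max a b} by move=> a b; rewrite maxr_pMr.
rewrite (big_morph _ Mmax (mulr0 t)); apply: eq_bigr => u _.
rewrite (big_morph _ Mmax (mulr0 t)); apply: eq_bigr => v _.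
by rewrite !ffunE -mulrBr.
Qed.

Lemma laplacian_euler (R : realType) (V : finType) (G : hypergraph R V) (p : R)
    (x y : {ffun V -> R}) :
  laplacian G p x y -> dotv x y = p * energy G p x.
Proof.
apply: subdifferential_euler => t t0; rewrite /energy mulrCA; congr (_ * _).
rewrite mulr_sumr; apply: eq_bigr => e _.
by rewrite (edge_maxZ _ _ (ltW t0)) powRM ?edge_max_ge0 ?ltW// mulrCA.
Qed.

(** * Distinct edges along a path *)

Lemma split_at_last {T : Type} (a : pred T) (s : seq T) :
  has a s -> exists s1 z s2, [/\ s = rcons s1 z ++ s2, a z & ~~ has a s2].
Proof.
elim: s => //= z s IH.
have [/IH[s1 [w [s2 [-> aw as2]]]] _|ns] := boolP (has a s).
  by exists (z :: s1), w, s2.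
by rewrite orbF => az; exists [::], z, s.
Qed.

(** Let e be the edge of the first step and w the last vertex of the path that
lies in e. Going from u to w costs [edge_max e x]; the rest of the path
avoids e, so every edge used for it, meeting that rest, differs from e. The
clause that each edge of F meets s is what carries this through the
induction. *)
Lemma path_distinct_edges (R : realType) (V : finType) (G : hypergraph R V)
    (x : {ffun V -> R}) (u : V) (s : seq V) :
  path (hadj G) u s ->
  exists F : {set {set V}},
    [/\ F \subset hedges G, (#|F| <= size s)%N,
        forall e, e \in F -> has (mem e) s &
        `|x u - x (last u s)| <= \sum_(e in F) edge_max e x].
Proof.
have [n] := ubnP (size s); elim: n u s => // n IH u [|v s] /= sn.
  move=> _; exists finset.set0; split; rewrite ?finset.sub0set ?cards0//.
    by move=> e; rewrite inE.
  by rewrite subrr normr0 big_set0.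
case/andP=> /existsP[e /andP[eE /andP[ue ve]]] vs.
have /split_at_last[s1 [w [s2 [sE we /hasPn es2]]]] : has (mem e) (v :: s).
  by rewrite /= ve.
have ws2 : path (hadj G) w s2.
  have : path (hadj G) u (v :: s).
    by rewrite /= vs andbT; apply/existsP; exists e; rewrite eE ue ve.
  by rewrite sE cat_path last_rcons => /andP[].
have ss2 : (size s2 <= size s)%N.
  by rewrite -ltnS -[(size s).+1]/(size (v :: s)) sE size_cat size_rcons
     addSn ltnS leq_addl.
have [|F [FE Fs Fmeet Fx]] := IH w s2 _ ws2.
  by apply: leq_ltn_trans ss2 _.
(* The edges of F meet s2, whereas e does not. *)
have eF : e \notin F.
  by apply/negP => /Fmeet /hasP[z /es2 /negbTE /= ->].
exists (e |: F); split.
- by rewrite finset.subUset finset.sub1set eE.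
- by rewrite cardsU1 eF ltnS (leq_trans Fs).
- move=> e'; rewrite !inE => /orP[/eqP->|/Fmeet e's2]; first by rewrite ve.
  by rewrite -[_ || _]/(has (mem e') (v :: s)) sE has_cat e's2 orbT.
- have -> : last v s = last w s2.
    by rewrite -[LHS]/(last u (v :: s)) sE last_cat last_rcons.
  rewrite big_setU1//=; apply: le_trans (ler_distD (x w) _ _) _.
  apply: lerD => //; rewrite ler_norml lerNl opprB.
  by rewrite !edge_max_ge.
Qed.

(** * Deviation from the average on connected components *)

Section Poincare.
Variables (R : realType) (V : finType) (G : hypergraph R V).
Implicit Types (x : {ffun V -> R}) (S : {set V}) (p : R).

Lemma connect_hadj_equiv :
  {in [set: V] & &, equivalence_rel (connect (hadj G))}.
Proof.
apply: in3W; apply/equivalence_relP; split; first exact: connect0.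
move=> u v uv; apply: same_connect => //; apply: sym_connect_sym.
by move=> a b; apply: eq_existsb => e; rewrite [(a \in e) && _]andbC.
Qed.

Lemma components_partition : finset.partition (components G) [set: V].
Proof. exact: equivalence_partitionP connect_hadj_equiv. Qed.

Lemma in_component S u v :
  S \in components G -> u \in S -> (v \in S) = connect (hadj G) u v.
Proof.
move=> SG uS; rewrite -(pblock_equivalence_partition connect_hadj_equiv)//.
by rewrite (def_pblock (partition_trivIset components_partition) SG uS).
Qed.

Lemma component_averageE x S v :
  S \in components G -> v \in S ->
  component_average G x v = (\sum_(u in S) x u) / #|S|%:R.
Proof.
move=> SG vS; rewrite /component_average sum_ffunE (bigD1 S)//= [X in _ + X]big1.
  by rewrite addr0 !ffunE vS [LHS]mulr1.
move=> S' /andP[S'G S'S]; rewrite !ffunE.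
have -> : (v \in S') = false; last by rewrite scaler0.
apply: contraNF S'S => vS'.
have tI := partition_trivIset components_partition.
by rewrite -(def_pblock tI S'G vS') (def_pblock tI SG vS).
Qed.

(** A simple path inside S has fewer than [#|S|] steps, which bounds the number
of distinct edges in the power mean inequality. *)
Lemma oscillation_le p x S u v :
  1 <= p -> S \in components G -> u \in S -> v \in S ->
  `|x u - x v| <= #|S|%:R `^ (1 - p^-1) *
    (\sum_(e in hedges G) edge_max e x `^ p) `^ p^-1.
Proof.
move=> p1 SG uS; have p0 : 0 < p by apply: lt_le_trans p1.
rewrite (in_component _ SG uS) => /connectP[s0 us0 ->].
case: (shortenP us0) => s us Us _.
have [F [FE Fs _ /le_trans->//]] := path_distinct_edges x us.
have FS : (#|F| <= #|S|)%N.
  apply: leq_trans Fs _; apply: ltnW.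
  rewrite -[(size s).+1]/(size (u :: s)) -(card_uniqP Us).
  apply/subset_leq_card/fintype.subsetP => z zs.
  by rewrite (in_component _ SG uS) (path_connect us).
apply: le_trans (sum_le_power_mean p1 _) _ => [e _|]; first exact: edge_max_ge0.
apply: ler_pM; rewrite ?powR_ge0//.
  apply: ge0_ler_powR; rewrite ?nnegrE ?ler_nat//.
  by rewrite subr_ge0 invf_le1.
apply: ge0_ler_powR; rewrite ?nnegrE ?invr_ge0 ?(ltW p0)//;
  try by apply: sumr_ge0 => e _; exact: powR_ge0.
rewrite [leRHS](big_setID F)/= (finset.setIidPr FE) lerDl.
by apply: sumr_ge0 => e _; exact: powR_ge0.
Qed.

Lemma l1_deviation_le p x :
  1 <= p ->
  \sum_v `|(x - component_average G x) v| <=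
    (\sum_(S in components G) #|S|%:R `^ (2 - p^-1)) *
    (\sum_(e in hedges G) edge_max e x `^ p) `^ p^-1.
Proof.
move=> p1; set T := _ `^ p^-1.
have -> : \sum_v `|(x - component_average G x) v| =
    \sum_(S in components G) \sum_(v in S) `|(x - component_average G x) v|.
  rewrite -(set_partition_big _ components_partition).
  by apply: eq_bigl => v; rewrite inE.
rewrite mulr_suml; apply: ler_sum => S SG.
have [S0|S0] := posnP #|S|.
  rewrite (cards0_eq S0) big_set0; apply: mulr_ge0; exact: powR_ge0.
have -> : #|S|%:R `^ (2 - p^-1) * T = \sum_(v in S) (#|S|%:R `^ (1 - p^-1) * T).
  rewrite sumr_const -[RHS]mulr_natl mulrA; congr (_ * T).
  have -> : 2 - p^-1 = 1 + (1 - p^-1) by ring.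
  by rewrite powRD ?powRr1// pnatr_eq0 -lt0n S0 implybT.
apply: ler_sum => v vS; rewrite !ffunE (component_averageE _ SG vS).
apply: dist_mean_le => [|u uS]; first by rewrite -card_gt0.
exact: oscillation_le.
Qed.

Lemma min_weight_le e : e \in hedges G -> min_weight G <= hweight G e.
Proof.
move=> eG; apply: ge_inf; last by exists e.
by exists 0 => _ [e' /= e'G <-]; exact/ltW/hweight_gt0.
Qed.

(** The infimum is attained because there are finitely many edges; over
infinitely many, positive weights could accumulate at 0. *)
Lemma min_weight_gt0 : hedges G <> finset.set0 -> 0 < min_weight G.
Proof.
move=> /eqP/set0Pn[e0 e0G].
case: (arg_minP (hweight G) e0G) => e eG le_e.
apply: lt_le_trans (hweight_gt0 eG) _; apply: lb_le_inf.
  by exists (hweight G e0), e0.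
by move=> _ [e' e'G <-]; exact: le_e.
Qed.

End Poincare.

Theorem theorem2p6 (R : realType) (V : finType) (G : hypergraph R V)
    (hE : hedges G <> finset.set0) (q : \bar R) (hq : (1%:E <= q)%E)
    (p : R) (hp : 1 <= p) (x y : {ffun V -> R}) (hy : laplacian G p x y) :
  lqnorm q (x - component_average G x) `^ p <= poincare_const G p * dotv x y /\
  poincare_const G p * dotv x y = p * poincare_const G p * energy G p x.
Proof.
have p0 : 0 < p by apply: lt_le_trans hp.
rewrite (laplacian_euler hy); split; last by rewrite mulrCA mulrA.
set T := \sum_(e in hedges G) edge_max e x `^ p.
set B := \sum_(S in components G) #|S|%:R `^ (2 - p^-1).
have T0 : 0 <= T by apply: sumr_ge0 => e _; exact: powR_ge0.
have B0 : 0 <= B by apply: sumr_ge0 => e _; exact: powR_ge0.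
have lq := le_trans (lqnorm_le_l1 (x - component_average G x) hq)
  (l1_deviation_le G x hp).
have m0 := min_weight_gt0 hE.
have mT : T <= (min_weight G)^-1 * (p * energy G p x).
  rewrite /energy mulVKf ?gt_eqF// [leRHS]mulrC ler_pdivlMr// mulrC.
  rewrite mulr_sumr; apply: ler_sum => e eG.
  by apply: ler_wpM2r; [exact: powR_ge0|exact: min_weight_le].
apply: (@le_trans _ _ (B `^ p * T)).
  have -> : B `^ p * T = (B * T `^ p^-1) `^ p.
    by rewrite powRM ?powR_ge0// -powRrM mulVf ?gt_eqF// powRr1.
  apply: ge0_ler_powR;
    by rewrite ?nnegrE ?(ltW p0) ?lqnorm_ge0 ?mulr_ge0 ?powR_ge0.
rewrite /poincare_const -/B [_^-1 * _]mulrC -mulrA.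
by apply: ler_wpM2l => //; exact: powR_ge0.
Qed.
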